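(* Let $\mathbf X={}^{T}(x_0,x_1,x_2)$ be real numbers with $0<x_0<x_1<x_2$ that are rationally dependent. Then the Smallest Vector Algorithm applied to $\mathbf X$ produces, at some step $s$, an integer triple $(\mathbf g_0^{(s)},\mathbf g_1^{(s)},\mathbf g_2^{(s)})$ such that $\|\mathbf g_0^{(s)\prime\prime}\|=\mathbf g_0^{(s)}\bullet\mathbf X=0$. In particular, $\mathbf g_0^{(s)}$ gives the coefficients of an integral linear dependence relation among $x_0,x_1,x_2$.
   Context: Use the Euclidean norm and inner product $\bullet$ on $\mathbb R^3$. Set $\mathbb D=\mathbb R\mathbf X$ and $\mathbb P=\mathbb D^{\perp}$. For $\mathbf h\in\mathbb R^3$, write $\mathbf h'$ for its orthogonal projection on $\mathbb P$ and $\mathbf h''$ for its orthogonal projection on $\mathbb D$. The Smallest Vector Algorithm (SVA) produces integer $3\times3$ matrices $\mathbf G^{(s)}=(\mathbf g_0^{(s)},\mathbf g_1^{(s)},\mathbf g_2^{(s)})$, given by their columns, as follows. - $\mathbf G^{(0)}=\mathbf I$. - Given $\mathbf G^{(s)}$ (superscripts omitted), let $\Delta_{\min}=\min(\|\mathbf g_1'-\mathbf g_0'\|,\|\mathbf g_2'-\mathbf g_1'\|,\|\mathbf g_2'-\mathbf g_0'\|)$. Define $(\mathbf f_0,\mathbf f_1,\mathbf f_2)$ by: - $(\mathbf g_0,\mathbf g_1-\mathbf g_0,\mathbf g_2)$ if $\Delta_{\min}=\|\mathbf g_1'-\mathbf g_0'\|$; - $(\mathbf g_0,\mathbf g_1,\mathbf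 g_2-\mathbf g_1)$ if $\Delta_{\min}=\|\mathbf g_2'-\mathbf g_1'\|$; - $(\mathbf g_0,\mathbf g_1,\mathbf g_2-\mathbf g_0)$ if $\Delta_{\min}=\|\mathbf g_2'-\mathbf g_0'\|$. - $\mathbf G^{(s+1)}$ is any permutation of the columns $\mathbf f_0,\mathbf f_1,\mathbf f_2$ such that $\|\mathbf g_0^{(s+1)\prime\prime}\|\le\|\mathbf g_1^{(s+1)\prime\prime}\|\le\|\mathbf g_2^{(s+1)\prime\prime}\|$. *)

(* Defs.v *)
From HB Require Import structures.
From mathcomp Require Import all_boot all_order all_algebra all_fingroup.
From mathcomp Require Import reals.

Set Implicit Arguments.
Unset Strict Implicit.
Unset Printing Implicit Defensive.

Import Order.TTheory GRing.Theory Num.Theory.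
Local Open Scope ring_scope.

Definition dot (R : realType) (u v : 'cV[R]_3) : R := \sum_i u i 0 * v i 0.

Definition enorm (R : realType) (u : 'cV[R]_3) : R := Num.sqrt (dot u u).

Definition rvec (R : realType) (h : 'cV[int]_3) : 'cV[R]_3 :=
  map_mx (fun z : int => z%:~R) h.
Arguments rvec R h : clear implicits.

(* Orthogonal projections h'' on the line D = R X and h' on P = D^perp, for
   X != 0; see projDP, projPP and projPD below. *)
Definition projD (R : realType) (X h : 'cV[R]_3) : 'cV[R]_3 :=
  (dot h X / dot X X) *: X.

Definition projP (R : realType) (X h : 'cV[R]_3) : 'cV[R]_3 := h - projD X h.

Definition rationally_dependent (R : realType) (X : 'cV[R]_3) : Prop :=
  exists2 c : 'cV[rat]_3, c != 0 & \sum_i ratr (c i 0) * X i 0 = 0.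

Definition mx_of_cols (f0 f1 f2 : 'cV[int]_3) : 'M[int]_3 :=
  \matrix_(i, j) (nth 0 [:: f0; f1; f2] j) i 0.

Definition SVA_dist (R : realType) (X : 'cV[R]_3) (G : 'M[int]_3) (i j : 'I_3)
    : R :=
  enorm (projP X (rvec R (col j G)) - projP X (rvec R (col i G))).

Definition SVA_dmin (R : realType) (X : 'cV[R]_3) (G : 'M[int]_3) : R :=
  Num.min (Num.min (SVA_dist X G 0 1) (SVA_dist X G 1 2)) (SVA_dist X G 0 2).

(* A relation rather than a function: when the minimum is attained several
   times, each of the corresponding subtractions is allowed. *)
Variant SVA_subtract (R : realType) (X : 'cV[R]_3) (G : 'M[int]_3) :
    'M[int]_3 -> Prop :=
  | SVA_sub10 of SVA_dmin X G = SVA_dist X G 0 1 :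
      SVA_subtract X G (mx_of_cols (col 0 G) (col 1 G - col 0 G) (col 2 G))
  | SVA_sub21 of SVA_dmin X G = SVA_dist X G 1 2 :
      SVA_subtract X G (mx_of_cols (col 0 G) (col 1 G) (col 2 G - col 1 G))
  | SVA_sub20 of SVA_dmin X G = SVA_dist X G 0 2 :
      SVA_subtract X G (mx_of_cols (col 0 G) (col 1 G) (col 2 G - col 0 G)).

Definition SVA_sorted (R : realType) (X : 'cV[R]_3) (G : 'M[int]_3) : Prop :=
  enorm (projD X (rvec R (col 0 G))) <= enorm (projD X (rvec R (col 1 G)))
    <= enorm (projD X (rvec R (col 2 G))).

Definition SVA_step (R : realType) (X : 'cV[R]_3) (G G' : 'M[int]_3) : Prop :=
  exists F : 'M[int]_3, exists s : 'S_3,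
    [/\ SVA_subtract X G F, G' = col_perm s F & SVA_sorted X G'].

Definition SVA_run (R : realType) (X : 'cV[R]_3) (G : nat -> 'M[int]_3) : Prop :=
  G 0%N = 1%:M /\ forall s : nat, SVA_step X (G s) (G s.+1).

Lemma dot_neq0 (R : realType) (X : 'cV[R]_3) : X != 0 -> dot X X != 0.
Proof.
apply: contra => /eqP dX; apply/eqP/matrixP => i j; rewrite ord1 mxE.
have /(_ i isT)/eqP : forall k : 'I_3, true -> X k 0 * X k 0 = 0.
  by apply: (psumr_eq0P _ dX) => k _; rewrite -expr2 sqr_ge0.
by rewrite mulf_eq0 orbb => /eqP.
Qed.

Lemma projDP (R : realType) (X h : 'cV[R]_3) : exists a, projD X h = a *: X.
Proof. by exists (dot h X / dot X X). Qed.

Lemma projPP (R : realType) (X h : 'cV[R]_3) :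
  X != 0 -> dot (projP X h) X = 0.
Proof.
move=> X0; rewrite /projP /projD; set a := _ / _.
have -> : dot (h - a *: X) X = dot h X - a * dot X X.
  rewrite /dot mulr_sumr -sumrB; apply: eq_bigr => i _.
  by rewrite !mxE mulrBl -mulrA.
by rewrite divfK ?subrr // dot_neq0.
Qed.

Lemma projPD (R : realType) (X h : 'cV[R]_3) : projP X h + projD X h = h.
Proof. by rewrite subrK. Qed.

(* Main.v *)
Require Import Defs.
From mathcomp Require Import all_boot all_order all_algebra all_fingroup.
From mathcomp Require Import boolp reals.
From mathcomp Require Import ring lra zify.

Set Implicit Arguments.
Unset Strict Implicit.
Unset Printing Implicit Defensive.

Import Order.TTheory GRing.Theory Num.Theory.
Local Open Scope ring_scope.

(** Write [y_k = g_k . X] and suppose that no [y_k] ever vanishes: they are then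
    positive, and each step lowers one of them. The columns with [|g'| <= K] have
    finitely many heights [y], so some monotone [phi : R -> nat] makes
    [sum_k phi (y_k)], which never increases, drop whenever such a column takes
    part in a subtraction. Hence from some step on, only columns with [|g'| > K]
    take part in subtractions.

    On the other hand, [X] is a combination of the columns with positive
    coefficients, so [sum_k b_k g_k' = 0] with [b_k > 0]; and a nonzero integer
    relation [c] is [sum_k a_k g_k] with integers [a_k] such that
    [sum_k a_k y_k = 0], hence not all of the same sign. Together these place the
    [g_k'] within [|c|] of a line, one of them on the other side of the origin
    from the two others. The smallest side of such a flat triangle is at most
    [max_k |g_k'|] unless one of its endpoints has norm at most [5 |c|]. Taking
    [K = 5 |c|] above, [max_k |g_k'|] eventually stops growing, so it is bounded by
    some [B]; taking now [K = B], subtractions must stop: a contradiction. *)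

Lemma ord3P (k : 'I_3) : [\/ k = 0, k = 1 | k = 2].
Proof.
by case: k => [[|[|[|k]]]] // k_lt3; [constructor 1|constructor 2|constructor 3];
  apply: val_inj.
Qed.

Lemma ord3_third (p q : 'I_3) : p != q ->
  exists r : 'I_3, [/\ r != p, r != q & forall k, [\/ k = p, k = q | k = r]].
Proof.
by case: (ord3P p) (ord3P q) => -> [] -> // _; [exists 2 | exists 1 | exists 2
  | exists 0 | exists 1 | exists 0]; split=> // k; case: (ord3P k) => ->;
  by [constructor 1 | constructor 2 | constructor 3].
Qed.

Lemma ord3_others (w : 'I_3) : exists p q : 'I_3,
  [/\ p != w, q != w, p != q & forall k, [\/ k = w, k = p | k = q]].
Proof.
case: (ord3P w) => ->; [exists 1, 2 | exists 0, 2 | exists 0, 1]; split=> // k;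
  case: (ord3P k) => ->; by [constructor 1 | constructor 2 | constructor 3].
Qed.

Lemma sum_ord3 (V : nmodType) (F : 'I_3 -> V) (p q r : 'I_3) :
  p != q -> r != p -> r != q -> \sum_k F k = F p + F q + F r.
Proof.
move=> pq rp rq; rewrite (bigD1 p) //= (bigD1 q) 1?eq_sym //= (bigD1 r) ?rp //=.
rewrite big1 ?addr0 ?addrA // => k /andP[/andP[]].
by case: (ord3P p) (ord3P q) (ord3P r) (ord3P k) pq rp rq
  => -> [] -> [] -> [] ->.
Qed.

Section ZeroSums.
Variable R : realDomainType.

Lemma sumr_eq0_exists_gt0 (I : finType) (F : I -> R) i :
  \sum_k F k = 0 -> F i != 0 -> exists k, 0 < F k.
Proof.
move=> sumF0 Fi_neq0; apply/existsP; apply: contraNT Fi_neq0.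
rewrite negb_exists => /forallP F_le0.
have F_ge0 k : true -> 0 <= - F k by rewrite oppr_ge0 leNgt F_le0.
have /(psumr_eq0P F_ge0)/(_ i isT)/eqP : \sum_k - F k = 0 by rewrite sumrN sumF0 oppr0.
by rewrite oppr_eq0.
Qed.

Lemma sumr_eq0_le0 (I : finType) (F : I -> R) i :
  \sum_k F k = 0 -> (forall k, k != i -> 0 <= F k) -> F i <= 0.
Proof.
rewrite (bigD1 i) //= => /eqP; rewrite addr_eq0 => /eqP -> F_ge0.
by rewrite oppr_le0 sumr_ge0.
Qed.

Lemma ord3_same_sign (t : 'I_3 -> R) : exists w,
  (forall k, k != w -> 0 <= t k) \/ (forall k, k != w -> t k <= 0).
Proof.
have [t0|/ltW t0] := leP 0 (t 0); have [t1|/ltW t1] := leP 0 (t 1);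
  have [t2|/ltW t2] := leP 0 (t 2);
  [exists 0; left | exists 2; left | exists 1; left | exists 0; right
  | exists 0; left | exists 1; right | exists 2; right | exists 0; right];
  by move=> k; case: (ord3P k) => ->.
Qed.

End ZeroSums.

Section Seminorm.
Variables (R : realFieldType) (V : lmodType R).

Definition seminorm (N : V -> R) : Prop :=
  (forall u v, N (u + v) <= N u + N v) /\ (forall a u, N (a *: u) = `|a| * N u).

Variable N : V -> R.
Hypothesis N_seminorm : seminorm N.

Lemma seminorm0 : N 0 = 0.
Proof. by rewrite -(scale0r 0) N_seminorm.2 normr0 mul0r. Qed.

Lemma seminormN u : N (- u) = N u.
Proof. by rewrite -scaleN1r N_seminorm.2 normrN1 mul1r. Qed.

Lemma seminorm_distC u v : N (u - v) = N (v - u).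
Proof. by rewrite -seminormN opprB. Qed.

Lemma ler_seminormB u v : N (u - v) <= N u + N v.
Proof. by rewrite -(seminormN v) N_seminorm.1. Qed.

Lemma seminorm_ge0 u : 0 <= N u.
Proof. by have := N_seminorm.1 u (- u); rewrite subrr seminormN seminorm0; lra. Qed.

Lemma ler_dist_seminorm u v : `|N u - N v| <= N (u - v).
Proof.
rewrite ler_norml; have := N_seminorm.1 (u - v) v; have := N_seminorm.1 (v - u) u.
by rewrite !subrK seminorm_distC; lra.
Qed.

Lemma seminorm_dist_near_line (v u1 u2 : V) (t1 t2 C : R) :
  N (u1 - t1 *: v) <= C -> N (u2 - t2 *: v) <= C ->
  `|N (u1 - u2) - `|t1 - t2| * N v| <= C + C.
Proof.
move=> near1 near2; rewrite -N_seminorm.2 (le_trans (ler_dist_seminorm _ _)) //.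
have -> : u1 - u2 - (t1 - t2) *: v = (u1 - t1 *: v) - (u2 - t2 *: v).
  by rewrite scalerBl !opprB addrACA [RHS]addrACA (addrC (- u2)).
by rewrite (le_trans (ler_seminormB _ _)) // lerD.
Qed.

Definition straddles_line (C : R) (g : 'I_3 -> V) : Prop :=
  exists (v : V) (t : 'I_3 -> R) (w : 'I_3),
    [/\ t w <= 0, forall k, k != w -> 0 <= t k & forall k, N (g k - t k *: v) <= C].

Definition minor (a b : 'I_3 -> R) (k l : 'I_3) : R := b k * a l - b l * a k.

Lemma near_line_through (a b : 'I_3 -> R) (g : 'I_3 -> V) x y z :
    x != y -> z != x -> z != y -> \sum_k b k *: g k = 0 ->
    0 < b x <= `|minor a b x y| ->
  N (g y + (minor a b x z / minor a b x y) *: g z) <= N (\sum_k a k *: g k).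
Proof.
move=> xy zx zy bg0 /andP[bx_gt0 bx_le].
have minor_neq0 : minor a b x y != 0 by rewrite -normr_gt0 (lt_le_trans bx_gt0).
have elim_x : minor a b x y *: g y + minor a b x z *: g z = b x *: \sum_k a k *: g k.
  transitivity (\sum_k minor a b x k *: g k).
    by rewrite (sum_ord3 _ xy zx zy) /minor subrr scale0r add0r.
  rewrite -[RHS]subr0 -[in X in _ - X](scaler0 _ (a x)) -[in X in _ - X]bg0.
  rewrite !scaler_sumr -sumrB; apply: eq_bigr => k _.
  by rewrite !scalerA -scalerBl (mulrC (a x)).
have -> : g y + (minor a b x z / minor a b x y) *: g z =
          (b x / minor a b x y) *: \sum_k a k *: g k.
  apply: (scalerI minor_neq0); rewrite scalerDr !scalerA.
  by rewrite mulrC divfK // [in RHS]mulrC divfK.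
rewrite N_seminorm.2 ler_piMl ?seminorm_ge0 // normf_div (gtr0_norm bx_gt0).
by rewrite ler_pdivrMr ?mul1r // normr_gt0.
Qed.

(* The line is spanned by [g r], with [r] the third index; the coordinates [t] are
   proportional to the cross product of [a] and [b], hence orthogonal to [b]. *)
Lemma near_line_relations (a b : 'I_3 -> R) (g : 'I_3 -> V) p q :
    (forall k, 0 < b k) -> \sum_k b k *: g k = 0 -> 1 <= a p -> a q <= -1 ->
  exists (v : V) (t : 'I_3 -> R), \sum_k b k * t k = 0
    /\ forall k, N (g k - t k *: v) <= N (\sum_k a k *: g k).
Proof.
move=> b_gt0 bg0 ap aq.
have pq : p != q by apply/eqP => pq; move: ap aq; rewrite pq; lra.
have qp : q != p by rewrite eq_sym.
have [r [rp rq ord3_pqr]] := ord3_third pq.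
have minorC k l : minor a b l k = - minor a b k l by rewrite /minor opprB.
have [bp_gt0 bq_gt0] := (b_gt0 p, b_gt0 q).
have [bq_le bp_le] : b q <= minor a b q p /\ b p <= minor a b q p.
  by rewrite /minor; split; nra.
have minor_gt0 : 0 < minor a b q p by apply: lt_le_trans bq_le.
exists (g r), (fun k => if k == p then - (minor a b q r / minor a b q p)
                   else if k == q then minor a b p r / minor a b q p else 1); split.
  rewrite (sum_ord3 _ pq rp rq) eqxx (negPf qp) eqxx (negPf rp) (negPf rq).
  by move: minor_gt0; rewrite /minor => /gt_eqF/negbT ?; field.
move=> k; case: (ord3_pqr k) => ->.
- rewrite eqxx scaleNr opprK.
  by apply: near_line_through => //; rewrite bq_gt0 gtr0_norm.
- rewrite (negPf qp) eqxx -scaleNr -mulrN -invrN -minorC.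
  by apply: near_line_through => //; rewrite bp_gt0 minorC normrN gtr0_norm.
by rewrite (negPf rp) (negPf rq) scale1r subrr seminorm0 seminorm_ge0.
Qed.

Lemma straddles_line_relations (a b : 'I_3 -> R) (g : 'I_3 -> V) p q :
    (forall k, 0 < b k) -> \sum_k b k *: g k = 0 -> 1 <= a p -> a q <= -1 ->
  straddles_line (N (\sum_k a k *: g k)) g.
Proof.
move=> b_gt0 bg0 ap aq.
have straddles v (t : 'I_3 -> R) w : \sum_k b k * t k = 0 ->
    (forall k, k != w -> 0 <= t k) ->
    (forall k, N (g k - t k *: v) <= N (\sum_k a k *: g k)) ->
    straddles_line (N (\sum_k a k *: g k)) g.
  move=> bt0 t_ge0 near; exists v, t, w; split=> //.
  rewrite -(pmulr_rle0 _ (b_gt0 w)); apply: sumr_eq0_le0 bt0 _ => k kw.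
  by rewrite mulr_ge0 ?t_ge0 // ltW.
have [v [t [bt0 near]]] := near_line_relations b_gt0 bg0 ap aq.
have [w [t_ge0|t_le0]] := ord3_same_sign t; first exact: (straddles v t w).
apply: (straddles (- v) (fun k => - t k) w) => [|k kw|k].
- by under eq_bigr do rewrite mulrN; rewrite sumrN bt0 oppr0.
- by rewrite /= oppr_ge0 t_le0.
by rewrite scaleNr scalerN opprK.
Qed.

Lemma straddles_line_coordinate (C : R) (g : 'I_3 -> V) : straddles_line C g ->
  exists (x : 'I_3 -> R) (w : 'I_3),
    [/\ x w <= 0, forall k, k != w -> 0 <= x k, forall k, `|N (g k) - `|x k| | <= C
      & forall k l, `|N (g l - g k) - `|x l - x k| | <= C + C].
Proof.
move=> [v [t [w [tw_le0 t_ge0 near]]]]; have Nv_ge0 := seminorm_ge0 v.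
exists (fun k => t k * N v), w; split=> [|k kw|k|k l].
- by rewrite mulr_le0_ge0.
- by rewrite mulr_ge0 ?t_ge0.
- rewrite normrM (ger0_norm Nv_ge0) -N_seminorm.2.
  exact: le_trans (ler_dist_seminorm _ _) (near k).
rewrite -mulrBl normrM (ger0_norm Nv_ge0); exact: seminorm_dist_near_line.
Qed.

(* Let [p] and [q] be the two points on the same side, [q] being the closer one.
   If [q] is at least [3 C] away along the line, the side [pq] is short enough;
   otherwise [q] is near the origin, and so is [w] if [wp] is no longer than [pq]. *)
Lemma smallest_side_straddling (C rho : R) (g : 'I_3 -> V) i j :
    straddles_line C g -> i != j ->
    (forall k l, k != l -> N (g j - g i) <= N (g l - g k)) ->
    (forall k, N (g k) <= rho) ->
  [\/ N (g j - g i) <= rho, N (g i) <= 5 * C | N (g j) <= 5 * C].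
Proof.
move=> /straddles_line_coordinate[x [w [xw_le0 x_ge0 x_norm x_dist]]] ij smallest g_le.
have [p [q [pw qw pq ord3_wpq]]] := ord3_others w.
wlog x_le : p q pw qw pq ord3_wpq / x q <= x p.
  move=> base; have [|/ltW] := leP (x q) (x p); first exact: base.
  apply: base => [//|//||k]; first by rewrite eq_sym.
  by case: (ord3_wpq k) => ->; [constructor 1 | constructor 3 | constructor 2].
have [xp_ge0 xq_ge0] := (x_ge0 p pw, x_ge0 q qw).
have g_le_x k : N (g k) <= `|x k| + C.
  by have := x_norm k; rewrite ler_distl => /andP[].
have side_qp : N (g j - g i) <= x p - x q + (C + C).
  apply: le_trans (smallest q p _) _; first by rewrite eq_sym.
  by have := x_dist q p; rewrite ler_distl ger0_norm ?subr_ge0 // => /andP[].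
have [far_q|near_q] := leP (3 * C) (x q).
  constructor 1; have := g_le p; have := x_norm p.
  by rewrite ler_distl ger0_norm // => /andP[]; lra.
have gq_le : N (g q) <= 5 * C by have := g_le_x q; rewrite ger0_norm //; lra.
have gw_le : N (g j - g i) = N (g p - g w) -> N (g w) <= 5 * C.
  move=> side_wp; have := x_dist w p; have := g_le_x w; rewrite -side_wp.
  rewrite ler_distl ler0_norm // ger0_norm ?subr_ge0 ?(le_trans xw_le0) //.
  by move=> ? /andP[]; lra.
case: (ord3_wpq i) (ord3_wpq j) ij gw_le => -> [] ->; rewrite ?eqxx // => _ gw_le;
  by [constructor 2 | constructor 3 | constructor 2; exact: gw_le
     | constructor 3; apply: gw_le; exact: seminorm_distC].
Qed.

End Seminorm.

Lemma nonincreasing_nat_eventually_constant (u : nat -> nat) :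
    (forall n, u n.+1 <= u n)%N ->
  exists n0, forall n, (n0 <= n)%N -> u n = u n0.
Proof.
move=> u_le; have u_homo : {homo u : m n / (m <= n)%N >-> (n <= m)%N}.
  by apply: homo_leq => // m k l kl lm; apply: leq_trans kl.
have u_value : exists v, `[< exists n, u n = v >].
  by exists (u 0%N); apply/asboolP; exists 0%N.
case: (ex_minnP u_value) => _ /asboolP[n0 <-] u_min; exists n0 => n n0_le.
by apply/eqP; rewrite eqn_leq u_homo // u_min //; apply/asboolP; exists n.
Qed.

Section DroppingPotential.
Variable R : archiRealFieldType.

Definition drops_at (phi : R -> nat) (v : R) : Prop :=
  (forall z, 0 < z -> (phi (v - z)%R < phi v)%N) /\
  (forall y, v <= y -> (phi (y - v)%R < phi y)%N).

Lemma seq_pos_lower_bound (F : seq R) :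
  exists2 e : R, 0 < e & forall v, v \in F -> 0 < v -> e <= v.
Proof.
exists (\big[Order.min/1]_(v <- F | 0 < v) v).
  by apply: lt_bigmin; rewrite ?ltr01.
by move=> v vF v_gt0; apply: bigmin_inf_seq vF v_gt0 (lexx v).
Qed.

Lemma exists_dropping_potential (F : seq R) :
  exists2 phi : R -> nat, {homo phi : x y / x <= y >-> (x <= y)%N} &
    forall v, v \in F -> 0 < v -> drops_at phi v.
Proof.
have [e e_gt0 e_le] := seq_pos_lower_bound F.
pose rank (x : R) := count (fun v => v <= x) F.
pose floor_e (x : R) := Num.truncn (x / e).
have rank_homo : {homo rank : x y / x <= y >-> (x <= y)%N}.
  by move=> x y xy; apply: sub_count => v /le_trans; apply.
have floor_e_homo : {homo floor_e : x y / x <= y >-> (x <= y)%N}.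
  by move=> x y xy; rewrite le_truncn // ler_pM2r ?invr_gt0.
exists (fun x => rank x + floor_e x)%N.
  by move=> x y xy; rewrite leq_add ?rank_homo ?floor_e_homo.
move=> v vF v_gt0; split=> [z z_gt0|y v_le_y].
- rewrite -addSn leq_add ?floor_e_homo ?gerBl ?ltW // /rank.
  rewrite !(seq.permP (perm_to_rem vF)) /= lexx leNgt gtrBl z_gt0 add0n ltnS.
  by apply: sub_count => w /le_trans; apply; rewrite gerBl ltW.
rewrite -addnS leq_add ?rank_homo ?gerBl ?ltW // /floor_e truncn_gt_nat -natr1.
have floor_le : (Num.truncn ((y - v) / e))%:R <= (y - v) / e.
  by rewrite truncn_le divr_ge0 ?subr_ge0 // ltW.
rewrite (le_trans (lerD floor_le (lexx 1))) // mulrBl -lerBrDr lerD2l lerN2.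
by rewrite ler_pdivlMr // mul1r e_le.
Qed.

End DroppingPotential.

Lemma bounded_int_mx_finite m n (M : nat) :
  exists F : seq 'M[int]_(m, n),
    forall A : 'M_(m, n), (forall i j, `|A i j| <= M)%N -> A \in F.
Proof.
pose shift (e : 'I_(M + M).+1) : int := e%:Z - M%:Z.
exists [seq map_mx shift E | E : 'M_(m, n)] => A A_le; apply/imageP.
exists (map_mx (fun z : int => inord `|(z + M%:Z)%R|%N) A) => //.
apply/matrixP => i j; rewrite !mxE /shift; have := A_le i j.
by move=> A_le_ij; rewrite inordK ?gez0_abs ?addrK //; lia.
Qed.

Lemma rat_mx_clear_denominators m n (A : 'M[rat]_(m, n)) :
  exists2 d : int, d != 0 & exists B : 'M[int]_(m, n), map_mx intr B = d%:~R *: A.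
Proof.
pose d := \prod_ij denq (A ij.1 ij.2).
exists d; first by apply/prodf_neq0 => ij _; rewrite denq_neq0.
exists (\matrix_(i, j) (numq (A i j) * \prod_(kl | kl != (i, j)) denq (A kl.1 kl.2))).
apply/matrixP => i j; rewrite !mxE [d](bigD1 (i, j)) //= !intrM numqE.
by rewrite [RHS]mulrC mulrA.
Qed.

Lemma col_matrixP (T : Type) m n (A B : 'M[T]_(m, n)) :
  (forall j, col j A = col j B) <-> A = B.
Proof.
split=> [eq_col|-> //]; apply/matrixP => i j.
by have /colP/(_ i) := eq_col j; rewrite !mxE.
Qed.

Lemma col_col_perm (T : Type) m n (A : 'M[T]_(m, n)) (s : 'S_n) j :
  col j (col_perm s A) = col (s j) A.
Proof. by apply/colP => i; rewrite !mxE. Qed.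

Lemma mulmx_sum_col (R : comPzSemiRingType) m n (A : 'M[R]_(m, n)) (u : 'cV_n) :
  A *m u = \sum_k u k 0 *: col k A.
Proof.
apply/colP => i; rewrite mxE summxE; apply: eq_bigr => k _.
by rewrite !mxE mulrC.
Qed.

Lemma unitmx_col_neq0 (R : comUnitRingType) n (A : 'M[R]_n) j :
  A \in unitmx -> col j A != 0.
Proof.
move=> A_unit; apply: contraNneq (oner_neq0 R) => colA0.
have /matrixP/(_ j 0) : invmx A *m col j A = delta_mx j 0 by rewrite colE mulKmx.
by rewrite colA0 mulmx0 !mxE !eqxx => /esym/eqP.
Qed.

Definition sub_col (R : pzRingType) m n (A : 'M[R]_(m, n)) (i j : 'I_n)
    : 'M[R]_(m, n) :=
  A *m (1%:M - delta_mx i j).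

Lemma col_sub_col (R : pzRingType) m n (A : 'M[R]_(m, n)) i j k :
  col k (sub_col A i j) = if k == j then col j A - col i A else col k A.
Proof.
rewrite /sub_col mulmxBr mulmx1 raddfB /=.
have -> : col k (A *m delta_mx i j) = if k == j then col i A else 0.
  rewrite colE -mulmxA; case: eqVneq => [->|kj]; first by rewrite mul_delta_mx -colE.
  by rewrite mul_delta_mx_0 ?mulmx0 // eq_sym.
by case: eqVneq => [->|_]; rewrite ?subr0.
Qed.

Lemma sub_colK (R : pzRingType) m n (A : 'M[R]_(m, n)) i j :
  i != j -> sub_col A i j *m (1%:M + delta_mx i j) = A.
Proof.
move=> ij; rewrite -mulmxA mulmxDr mulmx1 mulmxBl mul1mx.
by rewrite mul_delta_mx_0 1?eq_sym // subr0 subrK mulmx1.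
Qed.

Lemma map_sub_col (R S : pzRingType) (f : {rmorphism R -> S}) m n
    (A : 'M[R]_(m, n)) i j :
  map_mx f (sub_col A i j) = sub_col (map_mx f A) i j.
Proof. by rewrite map_mxM map_mxB map_mx1 map_delta_mx. Qed.

Lemma unitmx_sub_col (R : comUnitRingType) n (A : 'M[R]_n) i j :
  i != j -> A \in unitmx -> sub_col A i j \in unitmx.
Proof. by move=> ij; rewrite -{1}(sub_colK A ij) unitmx_mul => /andP[]. Qed.

Lemma coord_gt0_neq0 (R : numDomainType) n (u : 'cV[R]_n) i : 0 < u i 0 -> u != 0.
Proof. by apply: contraTneq => ->; rewrite mxE ltxx. Qed.

Section EuclideanNorm.
Variable R : realType.
Implicit Types (u v w X : 'cV[R]_3) (a : R).

Lemma dotDl u v w : dot (u + v) w = dot u w + dot v w.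
Proof. by rewrite -big_split; apply: eq_bigr => i _; rewrite !mxE mulrDl. Qed.

Lemma dotZl a u w : dot (a *: u) w = a * dot u w.
Proof. by rewrite mulr_sumr; apply: eq_bigr => i _; rewrite !mxE mulrA. Qed.

Lemma dotC u v : dot u v = dot v u.
Proof. by apply: eq_bigr => i _; rewrite mulrC. Qed.

Lemma dotBl u v w : dot (u - v) w = dot u w - dot v w.
Proof. by rewrite dotDl -scaleN1r dotZl mulN1r. Qed.

Lemma dot0l u : dot 0 u = 0.
Proof. by rewrite -(scale0r 0) dotZl mul0r. Qed.

Lemma dot_mulmxl n (A : 'M[R]_(3, n)) (b : 'cV_n) w :
  dot (A *m b) w = \sum_k b k 0 * dot (col k A) w.
Proof.
rewrite mulmx_sum_col; under [RHS]eq_bigr do rewrite -dotZl.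
by apply: (big_morph ((@dot R)^~ w)) => [u v|]; rewrite ?dotDl ?dot0l.
Qed.

Lemma dot_ge0 u : 0 <= dot u u.
Proof. by apply: sumr_ge0 => i _; rewrite -expr2 sqr_ge0. Qed.

Lemma enorm_ge0 u : 0 <= enorm u. Proof. exact: sqrtr_ge0. Qed.

Lemma sqr_enorm u : enorm u ^+ 2 = dot u u.
Proof. by rewrite sqr_sqrtr ?dot_ge0. Qed.

Lemma enorm_gt0 X : X != 0 -> 0 < enorm X.
Proof. by rewrite lt_def enorm_ge0 andbT -sqrf_eq0 sqr_enorm; apply: dot_neq0. Qed.

Lemma dot_le_enorm u v : dot u v <= enorm u * enorm v.
Proof.
apply: (le_trans (ler_norm _)).
rewrite -(@ler_sqr R) ?nnegrE ?mulr_ge0 ?enorm_ge0 //.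
rewrite exprMn !sqr_enorm real_normK ?num_real // /dot !(@sum_ord3 _ _ 0 1 2) //.
have lagrange i j := sqr_ge0 (u i 0 * v j 0 - u j 0 * v i 0).
by have := lagrange 0 1; have := lagrange 0 2; have := lagrange 1 2; nra.
Qed.

Lemma enorm_seminorm : seminorm (@enorm R).
Proof.
split=> [u v|a u]; last first.
  by rewrite /enorm dotZl dotC dotZl mulrA -expr2 sqrtrM ?sqr_ge0 // sqrtr_sqr.
rewrite -(@ler_sqr R) ?nnegrE ?addr_ge0 ?enorm_ge0 //.
rewrite sqrrD !sqr_enorm dotDl ![dot _ (u + v)]dotC !dotDl (dotC v u).
by have := dot_le_enorm u v; lra.
Qed.

Lemma normr_coord_le_enorm u i : `|u i 0| <= enorm u.
Proof.
rewrite -(@ler_sqr R) ?nnegrE ?enorm_ge0 // sqr_enorm real_normK ?num_real //.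
rewrite /dot (bigD1 i) //= expr2 lerDl sumr_ge0 // => k _.
by rewrite -expr2 sqr_ge0.
Qed.

Lemma enorm_projD X u : X != 0 -> enorm (projD X u) = `|dot u X| / enorm X.
Proof.
move=> X_neq0; rewrite enorm_seminorm.2 normf_div -sqr_enorm normrX.
by rewrite (ger0_norm (enorm_ge0 X)) expr2 invfM mulrA divfK // gt_eqF ?enorm_gt0.
Qed.

Lemma projPB X u v : projP X (u - v) = projP X u - projP X v.
Proof. by rewrite /projP /projD dotBl mulrBl scalerBl !opprD addrACA. Qed.

Lemma projP_mulmx X n (A : 'M[R]_(3, n)) (b : 'cV_n) :
  projP X (A *m b) = \sum_k b k 0 *: projP X (col k A).
Proof.
rewrite /projP /projD dot_mulmxl mulmx_sum_col mulr_suml scaler_suml -sumrB.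
by apply: eq_bigr => k _; rewrite scalerBr scalerA mulrA.
Qed.

Lemma projP_id X : X != 0 -> projP X X = 0.
Proof. by move=> X_neq0; rewrite /projP /projD divff ?dot_neq0 // scale1r subrr. Qed.

End EuclideanNorm.

Section Height.
Variables (R : realType) (X : 'cV[R]_3).
Implicit Types (h c : 'cV[int]_3) (G : 'M[int]_3).

Definition height h : R := dot (rvec R h) X.
Definition transv h : 'cV[R]_3 := projP X (rvec R h).

Lemma heightB h1 h2 : height (h1 - h2) = height h1 - height h2.
Proof. by rewrite /height /rvec map_mxB dotBl. Qed.

Lemma transvB h1 h2 : transv (h1 - h2) = transv h1 - transv h2.
Proof. by rewrite /transv /rvec map_mxB projPB. Qed.

Lemma height_mulmx G (a : 'cV[int]_3) :
  height (G *m a) = \sum_k (a k 0)%:~R * height (col k G).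
Proof.
rewrite /height /rvec map_mxM dot_mulmxl; apply: eq_bigr => k _.
by rewrite mxE map_col.
Qed.

Lemma transv_mulmx G (a : 'cV[int]_3) :
  transv (G *m a) = \sum_k (a k 0)%:~R *: transv (col k G).
Proof.
rewrite /transv /rvec map_mxM projP_mulmx; apply: eq_bigr => k _.
by rewrite mxE map_col.
Qed.

Lemma exists_integer_relation : rationally_dependent X ->
  exists2 c : 'cV[int]_3, c != 0 & height c = 0.
Proof.
case=> q q_neq0 qX0; have [d d_neq0 [c cE]] := rat_mx_clear_denominators q.
have cE_coord i : (c i 0)%:~R = d%:~R * q i 0.
  by have /matrixP/(_ i 0) := cE; rewrite !mxE.
exists c.
  apply: contraNneq q_neq0 => c0; move/eqP: cE.
  by rewrite c0 map_mx0 eq_sym scaler_eq0 intr_eq0 (negPf d_neq0).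
rewrite -[RHS](mulr0 d%:~R) -qX0 mulr_sumr; apply: eq_bigr => i _.
by rewrite mxE mulrA -(ratr_int R (c i 0)) cE_coord rmorphM /= ratr_int.
Qed.

Hypothesis X_neq0 : X != 0.

Lemma bounded_vectors_finite (K Y : R) : exists F : seq 'cV[int]_3,
  forall h, enorm (transv h) <= K -> `|height h| <= Y -> h \in F.
Proof.
have [F F_in] := @bounded_int_mx_finite 3 1 (Num.bound (K + Y / enorm X)).
exists F => h hK hY; apply: F_in => i j; rewrite ord1.
have h_le : enorm (rvec R h) <= K + Y / enorm X.
  rewrite -(projPD X (rvec R h)) (le_trans ((enorm_seminorm R).1 _ _)) // lerD //.
  by rewrite enorm_projD // ler_pM2r ?invr_gt0 ?enorm_gt0.
have := normr_coord_le_enorm (rvec R h) i; rewrite mxE -intr_norm -abszE -pmulrn.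
move=> /le_trans/(_ h_le) coord_le; rewrite -(ler_nat R) (le_trans coord_le) //.
by rewrite ltW // archi_boundP // (le_trans (enorm_ge0 _) h_le).
Qed.

Lemma exists_height_potential (K Y : R) :
  exists2 phi : R -> nat, {homo phi : x y / x <= y >-> (x <= y)%N} &
    forall h, enorm (transv h) <= K -> 0 < height h <= Y -> drops_at phi (height h).
Proof.
have [F F_in] := bounded_vectors_finite K Y.
have [phi phi_homo phi_drops] := exists_dropping_potential [seq height h | h <- F].
exists phi => // h hK /andP[h_gt0 hY]; apply: phi_drops => //.
by apply/map_f/F_in => //; rewrite gtr0_norm.
Qed.

Definition in_positive_cone G : Prop :=
  exists2 b : 'cV[R]_3, (forall k, 0 < b k 0) & map_mx intr G *m b = X.

Lemma relation_coordinates G c :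
    G \in unitmx -> (forall k, 0 < height (col k G)) -> c != 0 -> height c = 0 ->
  exists (a : 'cV[int]_3) (p q : 'I_3), [/\ c = G *m a, 1 <= a p 0 & a q 0 <= -1].
Proof.
move=> G_unit height_gt0 c_neq0 height_c0.
pose a := invmx G *m c; have cE : c = G *m a by rewrite mulKVmx.
pose F k : R := (a k 0)%:~R * height (col k G).
have sumF0 : \sum_k F k = 0 by rewrite -height_mulmx -cE.
have sumNF0 : \sum_k - F k = 0 by rewrite sumrN sumF0 oppr0.
have [k Fk_neq0] : exists k, F k != 0.
  apply/existsP; apply: contraNT c_neq0; rewrite negb_exists => /forallP F0.
  rewrite cE (_ : a = 0) ?mulmx0 //; apply/colP => k; rewrite [RHS]mxE.
  have /negPn := F0 k; rewrite mulf_eq0 intr_eq0 (gt_eqF (height_gt0 k)) orbF.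
  by move/eqP.
have [p] := sumr_eq0_exists_gt0 sumF0 Fk_neq0.
rewrite pmulr_lgt0 // ltr0z gtz0_ge1 => ap_ge1.
have [|q] := sumr_eq0_exists_gt0 (i := k) sumNF0; first by rewrite oppr_eq0.
rewrite -mulNr pmulr_lgt0 // -mulrNz ltr0z gtz0_ge1 lerNr => aq_leN1.
by exists a, p, q.
Qed.

Lemma transv_straddles_line G c :
    G \in unitmx -> in_positive_cone G -> (forall k, 0 < height (col k G)) ->
    c != 0 -> height c = 0 ->
  straddles_line (@enorm R) (enorm (transv c)) (fun k => transv (col k G)).
Proof.
move=> G_unit [b b_gt0 GbX] height_gt0 c_neq0 height_c0.
have [a [p [q [-> ap_ge1 aq_leN1]]]] :=
  relation_coordinates G_unit height_gt0 c_neq0 height_c0.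
have sum_b0 : \sum_k b k 0 *: transv (col k G) = 0.
  transitivity (projP X (map_mx intr G *m b)); last by rewrite GbX projP_id.
  by rewrite projP_mulmx; apply: eq_bigr => k _; rewrite -map_col.
rewrite transv_mulmx.
apply: (straddles_line_relations (enorm_seminorm R) (p := p) (q := q) b_gt0 sum_b0).
  by rewrite ler1z.
by rewrite -(ler_int R) mulrN1z in aq_leN1.
Qed.

End Height.

Section Moves.
Variables (R : realType) (X : 'cV[R]_3).
Implicit Types G : 'M[int]_3.

Definition SVA_move G G' (i j : 'I_3) : Prop :=
  [/\ (i < j)%N, forall k l, k != l -> SVA_dist X G i j <= SVA_dist X G k l
    & exists s : 'S_3, G' = col_perm s (sub_col G i j)].

Lemma SVA_move_neq G G' i j : SVA_move G G' i j -> i != j.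
Proof. by case=> ij _ _; rewrite -val_eqE neq_ltn ij. Qed.

Lemma col_mx_of_cols f0 f1 f2 k :
  col k (mx_of_cols f0 f1 f2) = nth 0 [:: f0; f1; f2] k.
Proof. by apply/colP => i; rewrite !mxE. Qed.

Lemma SVA_distC G i j : SVA_dist X G i j = SVA_dist X G j i.
Proof. exact: (seminorm_distC (enorm_seminorm R)). Qed.

Lemma SVA_dmin_le G i j : i != j -> SVA_dmin X G <= SVA_dist X G i j.
Proof.
wlog ij_lt : i j / (i < j)%N => [base ij|_].
  have := ij; rewrite -val_eqE neq_ltn => /orP[] lt_ij; first exact: base.
  by rewrite SVA_distC base // eq_sym.
rewrite /SVA_dmin; move: (SVA_dist X G) => dist.
by case: (ord3P i) (ord3P j) ij_lt => -> [] -> // _; rewrite !ge_min lexx ?orbT.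
Qed.

Lemma SVA_step_move G G' : SVA_step X G G' -> exists i j, SVA_move G G' i j.
Proof.
move=> [F [s [G_F G'E _]]].
suff [i [j [ij dminE FE]]] : exists i j : 'I_3,
    [/\ (i < j)%N, SVA_dmin X G = SVA_dist X G i j & F = sub_col G i j].
  exists i, j; split=> [//|k l kl|]; first by rewrite -dminE SVA_dmin_le.
  by exists s; rewrite -FE.
case: G_F => dminE; [exists 0, 1 | exists 1, 2 | exists 0, 2]; split=> //;
  apply/col_matrixP => k; rewrite col_mx_of_cols col_sub_col;
  by case: (ord3P k) => ->.
Qed.

Lemma sum_col_move (F : 'cV[int]_3 -> nat) G G' i j : SVA_move G G' i j ->
  (\sum_k F (col k G') =
     F (col j G - col i G)%R + \sum_(k | k != j) F (col k G))%N.
Proof.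
move=> [_ _ [s ->]]; transitivity (\sum_k F (col k (sub_col G i j)))%N.
  rewrite [RHS](reindex_inj (@perm_inj _ s)); apply: eq_bigr => k _.
  by rewrite col_col_perm.
rewrite (bigD1 j) //= col_sub_col eqxx; congr (_ + _)%N.
by apply: eq_bigr => k /negPf kj; rewrite col_sub_col kj.
Qed.

Lemma col_move_cases (P : 'cV[int]_3 -> Prop) G G' i j : SVA_move G G' i j ->
  P (col j G - col i G) -> (forall k, P (col k G)) -> forall k, P (col k G').
Proof.
move=> [_ _ [s ->]] P_sub P_col k.
by rewrite col_col_perm col_sub_col; case: ifP.
Qed.

Lemma unitmx_move G G' i j : SVA_move G G' i j -> G \in unitmx -> G' \in unitmx.
Proof.
move=> mv G_unit; have [_ _ [s ->]] := mv.
by rewrite col_permE unitmx_mul unitmx_perm andbT unitmx_sub_col ?(SVA_move_neq mv).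
Qed.

Lemma in_positive_cone_move G G' i j :
  SVA_move G G' i j -> in_positive_cone X G -> in_positive_cone X G'.
Proof.
move=> mv [b b_gt0 GbX]; have [_ _ [s ->]] := mv.
exists (row_perm s ((1%:M + delta_mx i j) *m b)) => [k|].
  rewrite mxE mulmxDl mul1mx mxE ltr_wpDr // mxE sumr_ge0 // => l _.
  by rewrite mxE mulr_ge0 ?ler0n ?ltW.
rewrite map_col_perm map_sub_col mul_col_perm -row_permM mulVg row_perm1.
by rewrite mulmxA sub_colK ?(SVA_move_neq mv).
Qed.

Definition potential (phi : R -> nat) G : nat := \sum_k phi (height X (col k G)).

Lemma potential_move_le (phi : R -> nat) G G' i j : SVA_move G G' i j ->
    {homo phi : x y / x <= y >-> (x <= y)%N} -> 0 <= height X (col i G) ->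
  (potential phi G' <= potential phi G)%N.
Proof.
move=> mv phi_homo hi_ge0; rewrite /potential (sum_col_move (phi \o height X) mv).
by rewrite [leqRHS](bigD1 j) //= heightB leq_add2r phi_homo // gerBl.
Qed.

Lemma potential_move_lt (phi : R -> nat) G G' i j : SVA_move G G' i j ->
    0 < height X (col i G) <= height X (col j G) ->
    drops_at phi (height X (col i G)) \/ drops_at phi (height X (col j G)) ->
  (potential phi G' < potential phi G)%N.
Proof.
move=> mv /andP[hi_gt0 hi_le_hj] drops.
rewrite /potential (sum_col_move (phi \o height X) mv) [ltnRHS](bigD1 j) //=.
rewrite heightB ltn_add2r; case: drops => [[_ drops_i]|[drops_j _]].
  exact: drops_i.
exact: drops_j.
Qed.

End Moves.

Section Invariant.
Variables (R : realType) (X : 'cV[R]_3).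
Implicit Types G : 'M[int]_3.

Record SVA_invariant G : Prop := SVAInvariant {
  inv_unitmx : G \in unitmx;
  inv_positive_cone : in_positive_cone X G;
  inv_height_itv : forall k, 0 <= height X (col k G) <= X 2 0;
  inv_height_sorted :
    forall i j : 'I_3, (i <= j)%N -> height X (col i G) <= height X (col j G) }.

Lemma height_SVA_sorted G : X != 0 -> SVA_sorted X G ->
    (forall k, 0 <= height X (col k G)) ->
  forall i j : 'I_3, (i <= j)%N -> height X (col i G) <= height X (col j G).
Proof.
move=> X_neq0 sorted height_ge0.
have normE k : enorm (projD X (rvec R (col k G))) = height X (col k G) / enorm X.
  by rewrite enorm_projD // ger0_norm ?height_ge0.
move: sorted; rewrite /SVA_sorted !normE !ler_pM2r ?invr_gt0 ?enorm_gt0 //.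
move=> /andP[le01 le12] i j.
by case: (ord3P i) (ord3P j) => -> [] -> //= _; exact: le_trans le12.
Qed.

Hypotheses (X_gt0 : 0 < X 0 0) (X01 : X 0 0 < X 1 0) (X12 : X 1 0 < X 2 0).

Lemma SVA_invariant1 : SVA_invariant 1%:M.
Proof.
have heightE k : height X (col k 1%:M) = X k 0.
  rewrite /height /dot (bigD1 k) //= !mxE eqxx mul1r big1 ?addr0 // => l /negPf lk.
  by rewrite !mxE lk mul0r.
split=> [||k|i j]; first exact: unitmx1.
- exists X; last by rewrite map_mx1 mul1mx.
  by move=> k; case: (ord3P k) => ->; move: X_gt0 X01 X12; lra.
- by rewrite heightE; case: (ord3P k) => ->; move: X_gt0 X01 X12; lra.
by rewrite !heightE; case: (ord3P i) (ord3P j) => -> [] -> //= _;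
  move: X_gt0 X01 X12; lra.
Qed.

Lemma SVA_invariant_step G G' :
  SVA_invariant G -> SVA_step X G G' -> SVA_invariant G'.
Proof.
move=> [G_unit G_cone height_itv height_sorted] step.
have [i [j mv]] := SVA_step_move step; have [/ltnW ij _ _] := mv.
have height'_itv : forall k, 0 <= height X (col k G') <= X 2 0.
  apply: (col_move_cases (P := fun h => 0 <= height X h <= X 2 0) mv) => //.
  rewrite heightB.
  by have := height_sorted i j ij; have := height_itv i; have := height_itv j; lra.
split=> //; first exact: unitmx_move mv G_unit.
  exact: in_positive_cone_move mv G_cone.
have [F [s [_ _ G'_sorted]]] := step.
apply: height_SVA_sorted (coord_gt0_neq0 X_gt0) G'_sorted _ => k.
by case/andP: (height'_itv k).
Qed.

Lemma SVA_run_invariant (G : nat -> 'M[int]_3) s : SVA_run X G -> SVA_invariant (G s).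
Proof.
case=> G0 G_step; elim: s => [|s]; first by rewrite G0; exact: SVA_invariant1.
by move/SVA_invariant_step; apply.
Qed.

End Invariant.

Section RunWithoutRelation.
Variables (R : realType) (X : 'cV[R]_3).
Hypotheses (X_gt0 : 0 < X 0 0) (X01 : X 0 0 < X 1 0) (X12 : X 1 0 < X 2 0).
Variable G : nat -> 'M[int]_3.
Hypothesis G_run : SVA_run X G.
Hypothesis height_gt0 : forall s k, 0 < height X (col k (G s)).

Let X_neq0 : X != 0 := coord_gt0_neq0 X_gt0.
Let G_inv s : SVA_invariant X (G s) := SVA_run_invariant X_gt0 X01 X12 s G_run.

Lemma eventually_large_moves (K : R) : exists s0, forall s i j,
    (s0 <= s)%N -> SVA_move X (G s) (G s.+1) i j ->
  K < enorm (transv X (col i (G s))) /\ K < enorm (transv X (col j (G s))).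
Proof.
have [phi phi_homo phi_drops] := exists_height_potential X_neq0 K (X 2 0).
have height_itv s k : 0 < height X (col k (G s)) <= X 2 0.
  by rewrite height_gt0; case/andP: (inv_height_itv (G_inv s) k).
have potential_le s : (potential X phi (G s.+1) <= potential X phi (G s))%N.
  have [i [j mv]] := SVA_step_move (G_run.2 s).
  by apply: potential_move_le mv phi_homo _; rewrite ltW.
have [s0 const] := nonincreasing_nat_eventually_constant potential_le.
exists s0 => s i j s0_le mv.
have hi_le_hj : 0 < height X (col i (G s)) <= height X (col j (G s)).
  by have [/ltnW ij _ _] := mv; rewrite height_gt0 inv_height_sorted.
suff no_drop k : k = i \/ k = j -> K < enorm (transv X (col k (G s))).
  by split; apply: no_drop; [left | right].
move=> k_ij; rewrite ltNge; apply/negP => /phi_drops/(_ (height_itv s k)) drops.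
have := potential_move_lt mv hi_le_hj (phi := phi).
rewrite (const s.+1) ?(const s) ?ltnn ?leqW // => no_lt.
by apply/notF/no_lt; case: k_ij drops => -> ?; [left | right].
Qed.

Lemma eventually_transv_le_persists (c : 'cV[int]_3) :
    c != 0 -> height X c = 0 ->
  exists s0, forall s (rho : R), (s0 <= s)%N ->
    (forall k, enorm (transv X (col k (G s))) <= rho) ->
    forall k, enorm (transv X (col k (G s.+1))) <= rho.
Proof.
move=> c_neq0 hc0.
have [s0 large] := eventually_large_moves (5 * enorm (transv X c)).
exists s0 => s rho s0_le g_le.
have [i [j mv]] := SVA_step_move (G_run.2 s); have [_ smallest _] := mv.
apply: (col_move_cases (P := fun h => enorm (transv X h) <= rho) mv) => //.
have [far_i far_j] := large s i j s0_le mv.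
have straddles := transv_straddles_line X_neq0 (inv_unitmx (G_inv s))
  (inv_positive_cone (G_inv s)) (height_gt0 s) c_neq0 hc0.
rewrite transvB; case: (smallest_side_straddling (enorm_seminorm R) straddles
  (SVA_move_neq mv) smallest g_le) => //.
  by move/(lt_le_trans far_i); rewrite ltxx.
by move/(lt_le_trans far_j); rewrite ltxx.
Qed.

Lemma height_gt0_rationally_independent : ~ rationally_dependent X.
Proof.
move=> /exists_integer_relation[c c_neq0 hc0].
have [s0 persists] := eventually_transv_le_persists c_neq0 hc0.
pose B := \sum_k enorm (transv X (col k (G s0))).
have transv_le n k : enorm (transv X (col k (G (s0 + n)))) <= B.
  elim: n k => [|n IHn] k; last by rewrite addnS persists ?leq_addr.
  by rewrite addn0 /B (bigD1 k) //= lerDl sumr_ge0 // => l _; exact: enorm_ge0.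
have [s1 large] := eventually_large_moves B.
have [i [j mv]] := SVA_step_move (G_run.2 (s0 + s1)).
have [/lt_le_trans/(_ (transv_le _ _))] := large _ i j (leq_addl _ _) mv.
by rewrite ltxx.
Qed.

End RunWithoutRelation.

Theorem theorem4 (R : realType) (X : 'cV[R]_3)
    (X_gt0 : 0 < X 0 0) (X01 : X 0 0 < X 1 0) (X12 : X 1 0 < X 2 0)
    (X_dep : rationally_dependent X)
    (G : nat -> 'M[int]_3) (G_run : SVA_run X G) :
  exists s : nat,
    [/\ enorm (projD X (rvec R (col 0 (G s)))) = 0,
        dot (rvec R (col 0 (G s))) X = 0,
        col 0 (G s) != 0
      & (G s 0 0)%:~R * X 0 0 + (G s 1 0)%:~R * X 1 0
          + (G s 2 0)%:~R * X 2 0 = 0].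
Proof.
have inv s := SVA_run_invariant X_gt0 X01 X12 s G_run.
have [s h0] : exists s, height X (col 0 (G s)) = 0.
  apply: contrapT => no_zero.
  apply: (height_gt0_rationally_independent X_gt0 X01 X12 G_run _ X_dep) => s k.
  apply: (lt_le_trans _ (inv_height_sorted (inv s) (i := 0) (leq0n k))).
  have /andP[h0_ge0 _] := inv_height_itv (inv s) 0.
  by rewrite lt_def h0_ge0 andbT; apply/eqP => h0; apply: no_zero; exists s.
exists s; split=> //.
- by rewrite enorm_projD ?(coord_gt0_neq0 X_gt0) // -/(height X _) h0 normr0 mul0r.
- exact: unitmx_col_neq0 (inv_unitmx (inv s)).
by move: h0; rewrite /height /dot (@sum_ord3 _ _ 0 1 2) // !mxE.
Qed.
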